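(* Let $K$ be a field, let $a_1,\ldots,a_n$ be positive integers, and let $\lambda=\gcd(a_1,\ldots,a_n)$. Let $S$ be the numerical semigroup generated by $a_1,\ldots,a_n$, and $\widetilde S$ the one generated by $a_1/\lambda,\ldots,a_n/\lambda$. Let $A=K[t^{a_1},\ldots,t^{a_n}]\subset K[t]$, so that $A\simeq K[x_1,\ldots,x_n]/I(S)$, where $I(S)$ is the kernel of the $K$-algebra homomorphism $x_i\mapsto t^{a_i}$. Let $\mathrm{in}(I(S))$ be the initial ideal of $I(S)$ with respect to the weighted degree reverse lexicographic order with $x_n,\ldots,x_1$ (with $\deg x_i=a_i$, and $x_1$ the smallest variable). Then: 1. The inclusion $K[x_1]\subset A$ (where $x_1$ is identified with $t^{a_1}$) is a Noether normalization. Moreover, as $K[t^{a_1}]$-modules, $$A\simeq \bigoplus_{x_2^{k_2}\cdots x_n^{k_n}\notin \mathrm{in}(I(S))} K[t^{a_1}]\,[t^{k_2a_2+\cdots+k_na_n}],$$ where the direct sum runs over all $(k_2,\ldots,k_n)\in\mathbb N^{n-1}$ with $x_2^{k_2}\cdots x_n^{k_n}\notin \mathrm{in}(I(S))$. 2. The Hilbert-Poincaré series of $A$ is $$P_A(t)=\frac{\sum_{x_2^{k_2}\cdots x_n^{k_n}\notin \mathrm{in}(I(S))}t^{k_2a_2+\cdots+k_na_n}}{1-t^{a_1}}.$$ 3. The Frobenius number of $\widetilde S$ is $$g(\widetilde S)=\frac{\max\{k_2a_2+\cdots+k_na_n \mid x_2^{k_2}\cdots x_n^{k_n}\notin \ma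thrm{in}(I(S))\}-a_1}{\lambda}.$$
   Context: $\mathbb N$ denotes the nonnegative integers. The numerical semigroup generated by $b_1,\ldots,b_n$ is $\{k_1b_1+\cdots+k_nb_n \mid k_i\in\mathbb N\}$. The polynomial ring $R=K[x_1,\ldots,x_n]$ is graded by $\deg x_i=a_i$. The map $x_i\mapsto t^{a_i}$ is homogeneous, so $I(S)$ is homogeneous and $A\simeq R/I(S)$ is graded, with $A_l=A\cap K t^l$. The monomial order is the weighted degree reverse lexicographic order with $x_n\succ\cdots\succ x_1$. Monomials are first compared by weighted degree ($\deg x_i=a_i$). If $x^\alpha\ne x^\beta$ have equal weighted degree, then $x^\alpha\succ x^\beta$ if and only if the nonzero entry of $\alpha-\beta$ of smallest index is negative. The initial ideal $\mathrm{in}(I(S))$ is the ideal generated by the leading monomials of all nonzero elements of $I(S)$. $K[t^{a_1}]\,[t^s]$ denotes the free rank-one $K[t^{a_1}]$-submodule $K[t^{a_1}]\cdot t^s$ of $K[t]$ generated by $t^s$. A Noether normalization of $A$ is a polynomial subring over which $A$ is a finitely generated module. The Hilbert-Poincaré series of $A$ is $P_A(t)=\sum_{l\in\mathbb Z}(\dim_K A_l)\,t^l$. For a numerical semigroup $T\subset\mathbb N$ whose generators have gcd $1$, the Frobenius number $g(T)$ is the largest integer not in $T$ (so $g(T)=-1$ if $T=\mathbb N$). *)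

(* Defs.v *)
From HB Require Import structures.
From mathcomp Require Import all_boot all_order all_algebra finmap.
(* The notations of monalg ({mpoly _[_]}, 'X_{1.._}) would hide those of mpoly. *)
From mathcomp Require Import -(notations) monalg.
From mathcomp Require Import mpoly.

Set Implicit Arguments.
Unset Strict Implicit.
Unset Printing Implicit Defensive.

Import Order.TTheory GRing.Theory Num.Theory.
Local Open Scope ring_scope.

(* Indexing convention: there are n.+1 generators a_1, ..., a_{n+1}, stored as
   a : 'I_n.+1 -> nat with a_1 = a ord0; the variable x_1 is 'X_ord0. *)

Definition semigroup_gen (m : nat) (b : 'I_m -> nat) (s : nat) : Prop :=
  exists k : 'I_m -> nat, s = (\sum_(i < m) k i * b i)%N.

Definition gcd_gens (m : nat) (a : 'I_m -> nat) : nat :=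
  \big[gcdn/0%N]_(i < m) a i.

Definition in_int (T : nat -> Prop) (z : int) : Prop :=
  exists2 s : nat, z = s%:Z & T s.

Definition is_frobenius_number (T : nat -> Prop) (g : int) : Prop :=
  ~ in_int T g /\ forall z : int, g < z -> in_int T z.

Definition is_maximum (E : nat -> Prop) (M : nat) : Prop :=
  E M /\ forall s, E s -> (s <= M)%N.

(* K[y_1, ..., y_m] as a subset of K[t] *)
Definition subalg_gen (K : fieldType) (m : nat) (y : 'I_m -> {poly K})
  (p : {poly K}) : Prop :=
  exists q : {mpoly K[m]}, p = mmap (@polyC K) y q.

Definition rank_one_module (K : fieldType) (B : {poly K} -> Prop) (s : nat)
  (p : {poly K}) : Prop :=
  exists2 c, B c & p = c * 'X^s.

Definition fg_module (K : fieldType) (B A : {poly K} -> Prop) : Prop :=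
  exists (r : nat) (g : 'I_r -> {poly K}),
    (forall i, A (g i)) /\
    (forall p, A p -> exists c : 'I_r -> {poly K},
       (forall i, B (c i)) /\ p = \sum_(i < r) c i * g i).

(* K[z_1, ..., z_m] -> K[t], z_i |-> y_i, is injective with image inside A,
   and A is a finitely generated module over that image. *)
Definition noether_normalization (K : fieldType) (m : nat)
  (y : 'I_m -> {poly K}) (A : {poly K} -> Prop) : Prop :=
  [/\ injective (fun q : {mpoly K[m]} => mmap (@polyC K) y q),
      (forall p, subalg_gen y p -> A p)
    & fg_module (subalg_gen y) A].

(* phi restricts to an isomorphism from the B-submodule M of U onto the
   B-submodule N of V, where B is a subring of R. *)
Definition module_iso (R : comNzRingType) (U V : lmodType R) (B : R -> Prop)
  (M : U -> Prop) (N : V -> Prop) (phi : U -> V) : Prop :=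
  [/\ (forall u, M u -> N (phi u)),
      (forall b u u', B b -> M u -> M u' ->
         phi (b *: u + u') = b *: phi u + phi u'),
      (forall u u', M u -> M u' -> phi u = phi u' -> u = u')
    & (forall v, N v -> exists2 u, M u & phi u = v)].

(* External direct sum of the submodules W k of K[t], k ranging over the
   k : I such that P k.  Finitely supported families I -> K[t] are the
   elements of monalg.malg I {poly K}; only its K[t]-module structure is used. *)
Definition direct_sum (K : fieldType) (I : choiceType) (P : I -> Prop)
  (W : I -> {poly K} -> Prop) (f : monalg.malg I {poly K}) : Prop :=
  forall k, (P k -> W k (monalg.mcoeff k f)) /\
            (~ P k -> monalg.mcoeff k f = 0).

Definition sum_map (K : fieldType) (I : choiceType)
  (f : monalg.malg I {poly K}) : {poly K}^o :=
  \sum_(k <- monalg.msupp f) monalg.mcoeff k f.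

Definition semigroup_ring (K : fieldType) (m : nat) (a : 'I_m -> nat) :
  {poly K} -> Prop :=
  subalg_gen (fun i => 'X^(a i)).

Definition toric_ideal (K : fieldType) (m : nat) (a : 'I_m -> nat)
  (q : {mpoly K[m]}) : Prop :=
  mmap (@polyC K) (fun i => 'X^(a i)) q = 0.

Definition wdeg (m : nat) (a : 'I_m -> nat) (u : 'X_{1..m}) : nat :=
  (\sum_(i < m) u i * a i)%N.

(* u < v: at equal weight, the first nonzero entry of v - u is negative. *)
Definition wdegrevlex_lt (m : nat) (a : 'I_m -> nat) (u v : 'X_{1..m}) : Prop :=
  (wdeg a u < wdeg a v)%N \/
  (wdeg a u = wdeg a v /\
   exists i : 'I_m, (forall j : 'I_m, (j < i)%N -> v j = u j) /\
                    (v i)%:Z - (u i)%:Z < 0).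

Definition is_leading_monomial (K : fieldType) (m : nat) (a : 'I_m -> nat)
  (q : {mpoly K[m]}) (u : 'X_{1..m}) : Prop :=
  u \in msupp q /\
  forall v, v \in msupp q -> v != u -> wdegrevlex_lt a v u.

Definition ideal_gen (R : comNzRingType) (G : R -> Prop) (p : R) : Prop :=
  exists (r : nat) (c g : 'I_r -> R),
    (forall i, G (g i)) /\ p = \sum_(i < r) c i * g i.

Definition initial_ideal (K : fieldType) (m : nat) (a : 'I_m -> nat)
  (J : {mpoly K[m]} -> Prop) : {mpoly K[m]} -> Prop :=
  ideal_gen (fun p => exists (q : {mpoly K[m]}) (u : 'X_{1..m}),
    [/\ J q, q != 0, is_leading_monomial a q u & p = 'X_[u]]).

(* (k_2, ..., k_{n+1}) seen as the exponent of x_2^k_2 ... x_{n+1}^k_{n+1} *)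
Definition extend_exp (n : nat) (k : 'X_{1..n}) : 'X_{1..n.+1} :=
  [multinom (if unlift ord0 i is Some j then k j else 0%N) | i < n.+1].

Definition standard_exp (K : fieldType) (n : nat) (a : 'I_n.+1 -> nat)
  (k : 'X_{1..n}) : Prop :=
  ~ initial_ideal a (@toric_ideal K n.+1 a) 'X_[extend_exp k].

(* k_2 a_2 + ... + k_{n+1} a_{n+1} *)
Definition tail_weight (n : nat) (a : 'I_n.+1 -> nat) (k : 'X_{1..n}) : nat :=
  (\sum_(j < n) k j * a (lift ord0 j))%N.

Definition has_dim (K : fieldType) (V : lmodType K) (W : V -> Prop) (d : nat) :
  Prop :=
  exists b : 'I_d -> V,
    [/\ (forall i, W (b i)),
        (forall c : 'I_d -> K, \sum_(i < d) c i *: b i = 0 -> forall i, c i = 0)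
      & (forall v, W v -> exists c : 'I_d -> K, v = \sum_(i < d) c i *: b i)].

Definition graded_piece (K : fieldType) (A : {poly K} -> Prop) (l : nat)
  (p : {poly K}) : Prop :=
  A p /\ exists c : K, p = c *: 'X^l.

(* Formal power series over int are given by their coefficients.  Since A lies
   in K[t], A_l = 0 for l < 0, so no negative exponents are needed. *)
Definition is_hilbert_series (K : fieldType) (A : {poly K} -> Prop)
  (P : nat -> int) : Prop :=
  forall l, exists2 d : nat, has_dim (graded_piece A l) d & P l = d%:Z.

Definition series_of_poly (p : {poly int}) : nat -> int := fun l => p`_l.

Definition series_mul (F G : nat -> int) : nat -> int :=
  fun l => \sum_(i < l.+1) F i * G (l - i)%N.

(* F = N / D in int[[t]]: D is invertible there and F * D = N. *)
Definition is_series_quotient (F N D : nat -> int) : Prop :=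
  D 0%N \is a GRing.unit /\ series_mul F D =1 N.

(* Main.v *)
(* The toric ideal contains the binomials x^u - x^v with wdeg u = wdeg v, and
   every monomial of an element of it is matched by another one of the same
   weight.  Hence x^u is outside the initial ideal iff u is the smallest exponent
   of its weight, and each s in S is the weight of exactly one such u.  Since x_1
   is the smallest variable and the order is reverse lexicographic, this u has
   u_1 = 0 iff s - a_1 is not in S.  So (k_2, ..., k_n) |-> k_2 a_2 + ... + k_n a_n
   is a bijection from the standard exponents onto the Apery set of S with respect
   to a_1, which consists of the least element of S in each residue class modulo
   a_1 that meets S.  The decomposition of A is then the decomposition of
   polynomials by residue classes of exponents modulo a_1, and the Frobenius number
   comes from the largest Apery element. *)
Require Import Defs.
From HB Require Import structures.
From mathcomp Require Import all_boot all_order all_algebra finmap.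
From mathcomp Require Import -(notations) monalg.
From mathcomp Require Import mpoly.
From mathcomp Require Import zify.

Set Implicit Arguments.
Unset Strict Implicit.
Unset Printing Implicit Defensive.

Import Order.TTheory GRing.Theory Num.Theory.
Local Open Scope ring_scope.

(** * Weights and minimal exponents *)

Section WeightedDegree.
Variables (m : nat) (a : 'I_m -> nat).

Lemma wdegD u v : wdeg a (u + v)%MM = (wdeg a u + wdeg a v)%N.
Proof.
by rewrite /wdeg -big_split; apply: eq_bigr => i _; rewrite mnmDE mulnDl.
Qed.

Lemma wdegU i : wdeg a U_(i)%MM = a i.
Proof.
rewrite /wdeg (bigD1 i) //= mnm1E eqxx mul1n big1 ?addn0 // => j /negbTE ji.
by rewrite mnm1E eq_sym ji mul0n.
Qed.

Lemma wdegB u v : (v <= u)%MM -> wdeg a (u - v)%MM = (wdeg a u - wdeg a v)%N.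
Proof. by move=> vu; rewrite -{2}(submK vu) wdegD addnK. Qed.

Lemma semigroup_genE s : semigroup_gen a s <-> exists u, wdeg a u = s.
Proof.
split=> [[k ->]|[u <-]]; last by exists u.
by exists [multinom k i | i < m]; apply: eq_bigr => i _; rewrite mnmE.
Qed.

Lemma semigroup_gen0 : semigroup_gen a 0.
Proof.
by exists (fun=> 0%N); rewrite big1.
Qed.

Lemma semigroup_genD s s' :
  semigroup_gen a s -> semigroup_gen a s' -> semigroup_gen a (s + s').
Proof.
rewrite !semigroup_genE => -[u <-] [v <-]; exists (u + v)%MM; exact: wdegD.
Qed.

Lemma semigroup_genM c s : semigroup_gen a s -> semigroup_gen a (c * s).
Proof.
move=> hs; elim: c => [|c IH]; first exact: semigroup_gen0.
by rewrite mulSn; apply: semigroup_genD.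
Qed.

Lemma semigroup_gen_gen i : semigroup_gen a (a i).
Proof. by apply/semigroup_genE; exists U_(i)%MM; apply: wdegU. Qed.

Hypothesis a_gt0 : forall i, (0 < a i)%N.

Lemma mdeg_le_wdeg u : (mdeg u <= wdeg a u)%N.
Proof. by rewrite mdegE; apply: leq_sum => i _; apply: leq_pmulr. Qed.

(** Positive weights bound the degree of an exponent by its weight, so a finite search decides
    membership. *)
Definition in_semigroup s := [exists u : 'X_{1..m < s.+1}, wdeg a u == s].

Lemma in_semigroupP s : reflect (semigroup_gen a s) (in_semigroup s).
Proof.
apply: (iffP existsP) => [[u /eqP us]|/semigroup_genE[u us]].
  by apply/semigroup_genE; exists u.
have hu : (mdeg u < s.+1)%N by rewrite ltnS -us mdeg_le_wdeg.
by exists (BMultinom hu); apply/eqP.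
Qed.

(** At equal weight the order is the lexicographic order on exponent tuples, reversed; totality and
    extremal elements are inherited from there. *)
Lemma wdegrevlex_ltE u v : wdeg a u = wdeg a v ->
  wdegrevlex_lt a v u <->
  ((val u : m.-tuplelexi nat) < (val v : m.-tuplelexi nat))%O.
Proof.
move=> uv.
split=> [[|[_ [i [ji ii]]]]|/Order.TupleLexiOrder.ltxi_tuplePlt[i ji ii]].
- by rewrite uv ltnn.
- apply/Order.TupleLexiOrder.ltxi_tuplePlt; exists i => [j /ji //|].
  by have /= := ii; rewrite /fun_of_multinom ltEnat /=; lia.
right; split=> //; exists i; split=> [j /ji //|].
by move: ii; rewrite /fun_of_multinom ltEnat /=; lia.
Qed.

Lemma wdegrevlex_lt_total u v : u != v -> wdeg a u = wdeg a v ->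
  wdegrevlex_lt a v u \/ wdegrevlex_lt a u v.
Proof.
move=> neq uv; rewrite (wdegrevlex_ltE uv) (wdegrevlex_ltE (esym uv)).
apply/orP/Order.TotalTheory.lt_total.
by apply: contra neq => /eqP /val_inj ->.
Qed.

Lemma wdegrevlex_ltD w u v :
  wdegrevlex_lt a v u -> wdegrevlex_lt a (w + v)%MM (w + u)%MM.
Proof.
case=> [lt_vu|[eq_vu [i [ji ii]]]]; [left|right]; rewrite !wdegD ?ltn_add2l //.
rewrite eq_vu; split=> //; exists i; split=> [j /ji|]; rewrite !mnmDE; last by lia.
by move=> ->.
Qed.

Lemma wdegrevlex_lt_irr u : ~ wdegrevlex_lt a u u.
Proof. by rewrite wdegrevlex_ltE // ltxx. Qed.

Definition minimal_exp u :=
  forall v, wdeg a v = wdeg a u -> ~ wdegrevlex_lt a v u.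

Lemma minimal_exp_inj u v :
  minimal_exp u -> minimal_exp v -> wdeg a u = wdeg a v -> u = v.
Proof.
move=> hu hv uv; apply/eqP; apply/negPn/negP => neq.
by case: (wdegrevlex_lt_total neq uv); [apply: hu|apply: hv].
Qed.

Lemma minimal_exp_exists s :
  semigroup_gen a s -> exists2 u, minimal_exp u & wdeg a u = s.
Proof.
move/in_semigroupP=> /existsP[u0 hu0].
pose F (u : 'X_{1..m < s.+1}) := val (bmnm u) : m.-tuplelexi nat.
(* Because of the reversal, the lexicographically largest tuple of weight [s] is the smallest
   exponent. *)
have [u /eqP us umax] :=
  @Order.TotalTheory.arg_maxP _ _ _ u0 (fun u => wdeg a u == s) F hu0.
exists u => // v; rewrite us => vs; rewrite wdegrevlex_ltE ?us // => lt_uv.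
have hv : (mdeg v < s.+1)%N by rewrite ltnS -vs mdeg_le_wdeg.
by have := umax (BMultinom hv); rewrite /= vs eqxx leNgt lt_uv => /(_ isT).
Qed.

End WeightedDegree.

(** * Toric and initial ideals *)

Section SemigroupRing.
Variables (K : fieldType) (m : nat) (a : 'I_m -> nat).

Let y := fun i => 'X^(a i) : {poly K}.

Lemma mmap1_monomials u : mmap1 y u = 'X^(wdeg a u).
Proof.
rewrite /mmap1 -prodrXr; apply: eq_bigr => i _.
by rewrite -exprM mulnC.
Qed.

Lemma coef_mmap_monomials (q : {mpoly K[m]}) l :
  (mmap (@polyC K) y q)`_l = \sum_(u <- msupp q | wdeg a u == l) q@_u.
Proof.
rewrite /mmap coef_sum [RHS]big_mkcond /=; apply: eq_bigr => u _.
by rewrite mmap1_monomials coefCM coefXn eq_sym mulr_natr mulrb.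
Qed.

Lemma semigroup_ring0 : @semigroup_ring K m a 0.
Proof. by exists 0; rewrite mmap0. Qed.

Lemma semigroup_ringD (p q : {poly K}) :
  semigroup_ring a p -> semigroup_ring a q -> semigroup_ring a (p + q).
Proof. by move=> [p' ->] [q' ->]; exists (p' + q'); rewrite mmapD. Qed.

(** The ring is spanned over K by the powers of t with exponent in the semigroup, so membership can
    be read off the support. *)
Lemma semigroup_ringE (p : {poly K}) :
  semigroup_ring a p <-> forall l, p`_l != 0 -> semigroup_gen a l.
Proof.
split=> [[q ->] l|hp].
  rewrite coef_mmap_monomials => nz.
  have /hasP[u _ /eqP ul] : has (fun u => wdeg a u == l) (msupp q).
    apply: contraNT nz => /hasPn h; rewrite big_seq_cond big1 // => u /andP[/h].
    by move=> /negbTE ->.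
  by apply/semigroup_genE; exists u.
rewrite -(coefK p) poly_def; elim/big_ind: _ => [|p1 p2|i _]; first exact: semigroup_ring0.
  exact: semigroup_ringD.
have [->|nz] := eqVneq p`_i 0; first by exists 0; rewrite mmap0 scale0r.
have /semigroup_genE[u ul] := hp _ nz.
exists (p`_i *: 'X_[u]); rewrite mmapZ mmapX -/y mmap1_monomials ul.
by rewrite mul_polyC.
Qed.

Lemma semigroup_ringXn s :
  semigroup_gen a s -> @semigroup_ring K m a 'X^s.
Proof.
move=> hs; apply/semigroup_ringE => l; rewrite coefXn.
by case: (eqVneq l s) => [->|]; rewrite ?eqxx.
Qed.

Lemma toric_ideal_binomial u v :
  wdeg a u = wdeg a v -> toric_ideal a ('X_[u] - 'X_[v] : {mpoly K[m]}).
Proof.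
by move=> uv; rewrite /toric_ideal mmapB !mmapX -/y !mmap1_monomials uv subrr.
Qed.

(** Coefficients of equal weight sum to a coefficient of the image, which is 0; a single nonzero one
    could not cancel. *)
Lemma toric_ideal_same_weight (q : {mpoly K[m]}) u :
  toric_ideal a q -> u \in msupp q ->
  exists v, [/\ v \in msupp q, v != u & wdeg a v = wdeg a u].
Proof.
move=> q0 hu.
case: (boolP (has (fun v => (v != u) && (wdeg a v == wdeg a u)) (msupp q))).
  by case/hasP=> v hv /andP[vu /eqP e]; exists v.
move/hasPn=> nov; have := coef_mmap_monomials q (wdeg a u).
rewrite [mmap _ _ _]q0 coef0 -big_filter.
rewrite (bigD1_seq u) ?mem_filter ?eqxx ?filter_uniq ?msupp_uniq //=.
rewrite big_seq_cond big1 => [/esym/eqP|v].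
  by rewrite addr0 mcoeff_eq0 hu.
by rewrite mem_filter => /andP[/andP[vu /nov]]; rewrite vu andbT => /negbTE ->.
Qed.

Lemma initial_toric_idealP u :
  initial_ideal a (@toric_ideal K m a) 'X_[u] <->
  exists2 v, wdeg a v = wdeg a u & wdegrevlex_lt a v u.
Proof.
split=> [[r [c [g [hg e]]]]|[v vu lt_vu]]; last first.
  have neq : u != v.
    by apply/eqP => uv; move: lt_vu; rewrite uv; apply: wdegrevlex_lt_irr.
  (* The binomial with exponents [u] and [v] has leading exponent [u], which puts ['X_[u]] among the
     generators. *)
  have lead w : w \in msupp ('X_[u] - 'X_[v] : {mpoly K[m]}) -> w = u \/ w = v.
    rewrite mcoeff_msupp mcoeffB !mcoeffX.
    case: (eqVneq u w) => [-> _|_]; first by left.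
    case: (eqVneq v w) => [-> _|_]; first by right.
    by rewrite subrr eqxx.
  have hu : u \in msupp ('X_[u] - 'X_[v] : {mpoly K[m]}).
    rewrite mcoeff_msupp mcoeffB !mcoeffX eqxx [v == u]eq_sym (negbTE neq) subr0.
    exact: oner_neq0.
  exists 1%N, (fun=> 1), (fun=> 'X_[u]); split; last by rewrite big_ord1 mul1r.
  move=> _; exists ('X_[u] - 'X_[v]), u; split=> //.
  - exact: toric_ideal_binomial.
  - by apply: contraTneq hu => ->; rewrite msupp0.
  - by split=> // w /lead[->|->//]; rewrite eqxx.
have [i hi] : exists i, u \in msupp (c i * g i).
  apply/existsP.
  have : u \in msupp ('X_[u] : {mpoly K[m]}) by rewrite msuppX mem_seq1.
  apply: contraTT => /existsPn h; rewrite e -mcoeff_eq0 raddf_sum /=.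
  by apply/eqP/big1 => i _; apply/eqP; rewrite mcoeff_eq0 h.
have [q [w [q0 _ [hw lead_w] gi]]] := hg i.
move: hi; rewrite gi (perm_mem (msuppMX _ _)) => /mapP[w' _ ->].
(* Here [u] is [w + w'] with [w] leading in [q]. The partner [v] of the same weight lies below [w],
   and translation by [w'] preserves this. *)
have [v [hv neq vw]] := toric_ideal_same_weight q0 hw.
exists (w' + v)%MM; first by rewrite !wdegD vw addnC.
by rewrite [(w + w')%MM]addmC; apply: wdegrevlex_ltD; apply: lead_w.
Qed.

End SemigroupRing.

(** * Standard exponents and the Apery set *)

Section Apery.
Variables (K : fieldType) (n : nat) (a : 'I_n.+1 -> nat).
Hypothesis a_gt0 : forall i, (0 < a i)%N.

Let a1 := a ord0.
Let a1_gt0 : (0 < a1)%N. Proof. exact: a_gt0. Qed.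
Let S := semigroup_gen a.

(** The Apery set of [S] with respect to [a1]. The guard [a1 <= s] matters: for smaller [s] the
    truncated difference is 0, which lies in [S]. *)
Definition apery s :=
  in_semigroup a s && ~~ ((a1 <= s)%N && in_semigroup a (s - a1)).

Lemma apery_in_semigroup s : apery s -> S s.
Proof. by case/andP=> /(in_semigroupP a_gt0). Qed.

Lemma apery_not_sub s : S s -> ~ apery (s + a1).
Proof.
move=> hs /andP[_ /negP[]]; rewrite leq_addl addnK.
exact/(in_semigroupP a_gt0).
Qed.

Lemma semigroup_addM s j : S s -> S (s + j * a1).
Proof.
move=> hs; apply: semigroup_genD => //; apply: semigroup_genM.
exact: semigroup_gen_gen.
Qed.

(** Subtract [a1] as long as the result stays in [S]. *)
Lemma apery_decomp s : S s -> exists w j, apery w /\ s = (w + j * a1)%N.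
Proof.
elim/ltn_ind: s => s IH /(in_semigroupP a_gt0) hs.
have [hap|] := boolP (apery s); first by exists s, 0%N; rewrite addn0.
rewrite /apery hs negbK => /andP[le_s /(in_semigroupP a_gt0) hs'].
have [|w [j [hw e]]] := IH (s - a1)%N _ hs'.
  by rewrite ltn_subrL a_gt0 (leq_trans (a_gt0 ord0)).
by exists w, j.+1; split=> //; rewrite -(subnK le_s) e mulSn; lia.
Qed.

(** A smaller [s] in the class would give [w = s + j * a1 + a1], so that [w - a1] would lie in
    [S]. *)
Lemma apery_min w s : apery w -> S s -> s = w %[mod a1] ->
  exists j, s = (w + j * a1)%N.
Proof.
move=> hw hs e; have [le_ws|lt_sw] := leqP w s.
  exists ((s - w) %/ a1)%N; rewrite divnK ?subnKC //.
  by rewrite -eqn_mod_dvd //; apply/eqP.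
have /dvdnP[j hj] : (a1 %| w - s)%N.
  by rewrite -eqn_mod_dvd ?(ltnW lt_sw) //; apply/eqP.
case: j hj => [|j] hj; first by move: lt_sw; rewrite -subn_gt0 hj.
case: (apery_not_sub (semigroup_addM j hs)).
suff -> : (s + j * a1 + a1 = w)%N by [].
by rewrite -addnA -mulSnr -hj subnKC // ltnW.
Qed.

Lemma apery_eqmod w w' : apery w -> apery w' -> w = w' %[mod a1] -> w = w'.
Proof.
move=> hw hw' e.
have [j ej] := apery_min hw' (apery_in_semigroup hw) e.
have [j' ej'] := apery_min hw (apery_in_semigroup hw') (esym e).
lia.
Qed.

Lemma wdeg_extend_exp k : wdeg a (extend_exp k) = tail_weight a k.
Proof.
rewrite /wdeg /tail_weight big_ord_recl !mnmE unlift_none mul0n add0n.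
by apply: eq_bigr => j _; rewrite mnmE liftK.
Qed.

Lemma extend_exp_inj : injective (@extend_exp n).
Proof.
move=> k k' /mnmP e; apply/mnmP => j.
by have := e (lift ord0 j); rewrite !mnmE liftK.
Qed.

Lemma extend_expP (u : 'X_{1..n.+1}) : u ord0 = 0%N -> exists k, u = extend_exp k.
Proof.
move=> u0; exists [multinom u (lift ord0 j) | j < n]; apply/mnmP => i.
by rewrite mnmE; case: unliftP => [j ->|->]; rewrite ?mnmE.
Qed.

Lemma standard_expP k :
  standard_exp K a k <-> minimal_exp a (extend_exp k).
Proof.
rewrite /standard_exp initial_toric_idealP; split=> [h v vu lt_vu|h [v vu lt_vu]].
  by apply: h; exists v.
exact: h vu lt_vu.
Qed.

Lemma apery_minimal_exp u : minimal_exp a u -> apery (wdeg a u) <-> u ord0 = 0%N.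
Proof.
move=> umin; split=> [hap|u0].
  apply/eqP; rewrite -leqn0 leqNgt; apply/negP => u_gt0.
  (* Removing one factor x_1 shows that the weight minus [a1] is still in [S]. *)
  have leu : (U_(ord0) <= u)%MM.
    by apply/mnm_lepP => i; rewrite mnm1E; case: (eqVneq ord0 i) => [<-|].
  apply: (@apery_not_sub (wdeg a (u - U_(ord0))%MM)).
    by apply/semigroup_genE; exists (u - U_(ord0))%MM.
  by rewrite wdegB // wdegU subnK // -/a1 -(submK leu) wdegD wdegU leq_addl.
rewrite /apery; apply/andP; split.
  by apply/(in_semigroupP a_gt0)/semigroup_genE; exists u.
apply/negP=> /andP[le_a1 /(in_semigroupP a_gt0)/semigroup_genE[v hv]].
(* This exponent has a positive first entry where [u] has 0, hence is smaller than [u] at the same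
   weight. *)
have e : wdeg a (v + U_(ord0))%MM = wdeg a u by rewrite wdegD hv wdegU subnK.
apply: (umin _ e); right; split=> //; exists ord0; split=> //.
by rewrite u0 mnmDE mnm1E eqxx; lia.
Qed.

Lemma apery_tail_weight k : standard_exp K a k -> apery (tail_weight a k).
Proof.
move/standard_expP=> hk; rewrite -wdeg_extend_exp.
by apply/(apery_minimal_exp hk); rewrite mnmE unlift_none.
Qed.

Lemma tail_weight_inj k k' : standard_exp K a k -> standard_exp K a k' ->
  tail_weight a k = tail_weight a k' -> k = k'.
Proof.
move=> /standard_expP hk /standard_expP hk'; rewrite -!wdeg_extend_exp => e.
exact/extend_exp_inj/(minimal_exp_inj hk hk').
Qed.

Lemma apery_standard_exp s : apery s ->
  exists2 k, standard_exp K a k & tail_weight a k = s.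
Proof.
move=> hs; have [u umin us] := minimal_exp_exists a_gt0 (apery_in_semigroup hs).
move: hs; rewrite -us => /(apery_minimal_exp umin)/extend_expP[k e].
exists k; last by rewrite e wdeg_extend_exp.
by apply/standard_expP; rewrite -e.
Qed.

(** No exponent of an Apery element has an entry above [a1]: otherwise [a1] copies of [a i] could be
    traded for [a i] copies of [a1], and one of these removed. Hence the Apery set is finite. *)
Lemma apery_ub s : apery s -> (s <= \sum_i a1 * a i)%N.
Proof.
move=> hs; have /semigroup_genE[u us] := apery_in_semigroup hs.
rewrite -us; apply: leq_sum => i _; rewrite leq_mul2r; apply/orP; right.
rewrite leqNgt; apply/negP => lt_u.
have leu : (U_(i) *+ a1 <= u)%MM.
  by apply/mnm_lepP => j; rewrite mulmnE mnm1E; case: eqP => [<-|]; lia.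
have wU : wdeg a (U_(i) *+ a1)%MM = (a i * a1)%N.
  rewrite mulnC; elim: (a1) => [|c IH].
    by rewrite mulm0n /wdeg big1 // => j _; rewrite mnm0E.
  by rewrite mulmS wdegD wdegU IH mulSn.
set v := (u - U_(i) *+ a1)%MM.
have e : (wdeg a v + (a i).-1 * a1 + a1)%N = s.
  by rewrite -addnA -mulSnr prednK ?a_gt0 // -us -(submK leu) wdegD wU.
move: hs; rewrite -e; apply: apery_not_sub; apply: semigroup_addM.
by apply/semigroup_genE; exists v.
Qed.

Definition apery_seq := [seq s <- iota 0 (\sum_i a1 * a i).+1 | apery s].

Lemma mem_apery_seq s : (s \in apery_seq) = apery s.
Proof.
rewrite mem_filter mem_iota /= add0n ltnS.
by case hs: (apery s) => //=; apply: apery_ub.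
Qed.

Lemma apery_seq_uniq : uniq apery_seq.
Proof. exact/filter_uniq/iota_uniq. Qed.

(** Built by lifting the Apery list entry by entry, so that sums over [E] become sums over
    [apery_seq]. *)
Lemma standard_exp_enum : exists E : seq 'X_{1..n},
  [/\ uniq E, (forall k, k \in E <-> standard_exp K a k)
    & map (tail_weight a) E = apery_seq].
Proof.
have [E hE eE] : exists2 E : seq 'X_{1..n},
    (forall k, k \in E -> standard_exp K a k) & map (tail_weight a) E = apery_seq.
  have : all apery apery_seq by apply: filter_all.
  elim: apery_seq => [|s L IH]; first by exists [::].
  case/andP=> /apery_standard_exp[k hk ks] /IH[E hE eE].
  exists (k :: E); last by rewrite /= ks eE.
  by move=> k'; rewrite inE => /predU1P[->|/hE].
exists E; split=> //.
  by apply: (@map_uniq _ _ (tail_weight a)); rewrite eE apery_seq_uniq.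
move=> k; split=> [|hk]; first exact: hE.
have := apery_tail_weight hk; rewrite -mem_apery_seq -eE => /mapP[k' hk' e].
by rewrite (tail_weight_inj hk (hE _ hk') e).
Qed.

(** * Module structure *)

Let A := @semigroup_ring K n.+1 a.
Let B : {poly K} -> Prop := subalg_gen (fun _ : 'I_1 => 'X^a1).

Lemma subalg_x1E p : B p <-> forall l, p`_l != 0 -> (a1 %| l)%N.
Proof.
(* [B] is itself a semigroup ring, with the single generator [a1]. *)
rewrite [B p](semigroup_ringE (fun _ : 'I_1 => a1)); split=> h l /h.
  by case=> k ->; rewrite big_ord1 dvdn_mull.
by case/dvdnP=> j ->; exists (fun=> j); rewrite big_ord1.
Qed.

Lemma rank_one_moduleE s p : rank_one_module B s p <->
  forall l, p`_l != 0 -> exists j, l = (s + j * a1)%N.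
Proof.
split=> [[c /subalg_x1E hc ->] l|h].
  rewrite coefMXn; case: ltnP => [|le_sl /hc /dvdnP[j hj]]; first by rewrite eqxx.
  by exists j; rewrite -hj subnKC.
exists (drop_poly s p).
  apply/subalg_x1E => l; rewrite coef_drop_poly => /h[j hj].
  by apply/dvdnP; exists j; lia.
apply/polyP => l; rewrite coefMXn coef_drop_poly.
have [lt_ls|le_sl] := ltnP l s; last by rewrite subnK.
by apply/eqP; apply: contraTT lt_ls => /h[j ->]; rewrite -leqNgt leq_addr.
Qed.

Lemma rank_one_module_sub w p : S w -> rank_one_module B w p -> A p.
Proof.
move=> hw /rank_one_moduleE hp; apply/semigroup_ringE => l /hp[j ->].
exact: semigroup_addM.
Qed.

Definition residue_part w (p : {poly K}) :=
  \poly_(l < size p) (if l == w %[mod a1] then p`_l else 0).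

Lemma coef_residue_part w p l :
  (residue_part w p)`_l = if l == w %[mod a1] then p`_l else 0.
Proof.
rewrite coef_poly; case: ltnP => // /leq_sizeP -> //.
by rewrite if_same.
Qed.

(** Since [w] is least in its class within [S], every exponent of the residue part is [w] plus a
    multiple of [a1]. *)
Lemma residue_part_rank_one w p :
  apery w -> A p -> rank_one_module B w (residue_part w p).
Proof.
move=> hw /semigroup_ringE hp; apply/rank_one_moduleE => l.
rewrite coef_residue_part.
case: (eqVneq (l %% a1)%N (w %% a1)%N) => [e /hp hl|_]; last by rewrite eqxx.
exact: apery_min.
Qed.

(** Each exponent occurring in [p] is congruent to exactly one Apery element. *)
Lemma sum_residue_part p : A p -> \sum_(w <- apery_seq) residue_part w p = p.
Proof.
move/semigroup_ringE=> hp; apply/polyP => l; rewrite coef_sum.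
have [pl0|nz] := eqVneq p`_l 0.
  by rewrite big1 // => w _; rewrite coef_residue_part pl0 if_same.
have [w [j [hw lw]]] := apery_decomp (hp _ nz).
rewrite (bigD1_seq w) ?mem_apery_seq ?apery_seq_uniq //= big_seq_cond big1.
  by rewrite addr0 coef_residue_part lw addnC modnMDl eqxx.
move=> w' /andP[]; rewrite mem_apery_seq coef_residue_part => hw' neq.
case: eqP => // e; case/eqP: neq; apply: apery_eqmod => //.
by rewrite -e lw addnC modnMDl.
Qed.

Lemma noether_normalization_x1 : noether_normalization (fun _ : 'I_1 => 'X^a1) A.
Proof.
split=> [q q' e|p hp|].
(* Distinct powers of the one variable have distinct weights, so this coefficient of the image is
   the coefficient at [u]. *)
- apply/mpolyP => u; have := congr1 (fun p : {poly K} => p`_(u ord0 * a1)) e.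
  rewrite /= !(coef_mmap_monomials (fun=> a1)).
  have coefE (r : {mpoly K[1]}) :
      \sum_(v <- msupp r | wdeg (fun=> a1) v == (u ord0 * a1)%N) r@_v = r@_u.
    rewrite (eq_bigl (pred1 u)) => [|v]; last first.
      rewrite /wdeg big_ord1 eqn_pmul2r ?a_gt0 //=.
      by apply/eqP/eqP => [vu|-> //]; apply/mnmP => i; rewrite (ord1 i).
    have [hu|hu] := boolP (u \in msupp r).
      by rewrite -big_filter filter_pred1_uniq ?msupp_uniq // big_seq1.
    rewrite (memN_msupp_eq0 hu) big_seq_cond big1 // => v /andP[hv /eqP vu].
    by rewrite -vu hv in hu.
  by rewrite !coefE.
- apply/semigroup_ringE => l; move/subalg_x1E: hp => /[apply] /dvdnP[j ->].
  exact/semigroup_genM/semigroup_gen_gen.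
(* The module generators are the powers of t with Apery exponents; the coefficients are the residue
   parts divided by them. *)
pose w i := tnth (in_tuple apery_seq) i.
have hw i : apery (w i) by rewrite -mem_apery_seq mem_tnth.
exists (size apery_seq), (fun i => 'X^(w i)); split=> [i|p hp].
  exact/semigroup_ringXn/apery_in_semigroup.
exists (fun i => drop_poly (w i) (residue_part (w i) p)); split=> [i|].
  by have [c hc ->] := residue_part_rank_one (hw i) hp; rewrite drop_polyMXn_id.
rewrite -[LHS](sum_residue_part hp) big_tnth; apply: eq_bigr => i _.
by have [c _ ->] := residue_part_rank_one (hw i) hp; rewrite drop_polyMXn_id.
Qed.

(** Allows families with different supports to be summed over a common index set, as linearity of
    [sum_map] requires. *)
Lemma sum_map_widen (I : choiceType) (f : monalg.malg I {poly K}) (D : {fset I}) :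
  (monalg.msupp f `<=` D)%fset ->
  sum_map f = \sum_(k <- D) monalg.mcoeff k f.
Proof.
move=> le_fD; by apply: big_fset_incl => // k _; apply: mcoeff_outdom.
Qed.

Lemma sum_mapD (I : choiceType) : {morph @sum_map K I : f g / f + g}.
Proof.
move=> f g.
rewrite (sum_map_widen (monalg.msuppD_le f g)).
rewrite (sum_map_widen (fsubsetUl (monalg.msupp f) (monalg.msupp g))).
rewrite (sum_map_widen (fsubsetUr (monalg.msupp f) (monalg.msupp g))).
by rewrite -big_split; apply: eq_bigr => k _; rewrite monalg.mcoeffD.
Qed.

Lemma sum_mapZ (I : choiceType) b (f : monalg.malg I {poly K}) :
  sum_map (b *: f) = b *: sum_map f.
Proof.
rewrite (@sum_map_widen _ _ (monalg.msupp f)) ?monalg.msuppZ_le // scaler_sumr.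
by apply: eq_bigr => k _; rewrite monalg.mcoeffZ.
Qed.

Lemma sum_mapU (I : choiceType) (k : I) (x : {poly K}) :
  sum_map (mkmalgU k x) = x.
Proof.
rewrite (@sum_map_widen _ _ [fset k]%fset) ?monalg.msuppU_le //.
by rewrite big_seq_fset1 mcoeffUU.
Qed.

Let std := standard_exp K a.
Let M := direct_sum std (fun k => rank_one_module B (tail_weight a k)).

Lemma direct_sum_supp f k : M f -> k \in monalg.msupp f -> std k.
Proof.
move=> hf hk hin; have [_ /(_ (fun h => h hin)) /eqP] := hf k.
by rewrite monalg.mcoeff_eq0 hk.
Qed.

Lemma coef_direct_sum f k l : M f -> std k ->
  (monalg.mcoeff k f)`_l != 0 -> l = tail_weight a k %[mod a1].
Proof.
move=> hf hk; have [/(_ hk) /rank_one_moduleE h _] := hf k.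
by move=> /h[j ->]; rewrite addnC modnMDl.
Qed.

(** The components occupy disjoint residue classes modulo [a1], so each can be recovered from the
    sum. This gives injectivity of [sum_map]. *)
Lemma mcoeff_direct_sum f k l : M f -> std k ->
  (monalg.mcoeff k f)`_l =
  if l == tail_weight a k %[mod a1] then (sum_map f)`_l else 0.
Proof.
move=> hf hk; case: eqP => [e|neq]; last first.
  by apply/eqP; apply: contra_notT neq => /(coef_direct_sum hf hk).
have other k' : k' \in monalg.msupp f -> k' != k -> (monalg.mcoeff k' f)`_l = 0.
  move=> hk' neq; apply/eqP; apply: contraNT neq => nz; apply/eqP.
  have std' := direct_sum_supp hf hk'.
  apply: tail_weight_inj => //; apply: apery_eqmod; try exact: apery_tail_weight.
  by rewrite -e (coef_direct_sum hf std' nz).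
rewrite /sum_map coef_sum; have [hin|hout] := boolP (k \in monalg.msupp f).
  rewrite (bigD1_seq k) ?fset_uniq //= big_seq_cond big1 ?addr0 //.
  by move=> k' /andP[hk' neq]; apply: other.
rewrite mcoeff_outdom // coef0 big_seq big1 // => k' hk'.
by apply: other => //; apply: contraNneq hout => <-.
Qed.

Lemma direct_sum_iso : module_iso (V := {poly K}^o) B M A (@sum_map K 'X_{1..n}).
Proof.
split=> [f hf|b f g _ _ _|f g hf hg e|p hp].
- rewrite /sum_map big_seq; elim/big_ind: _ => [|p q|k hk];
    [exact: semigroup_ring0|exact: semigroup_ringD|].
  have hstd := direct_sum_supp hf hk; have [/(_ hstd) h _] := hf k.
  exact: rank_one_module_sub (apery_in_semigroup (apery_tail_weight hstd)) h.
- by rewrite sum_mapD sum_mapZ.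
- apply/malgP => k; apply/polyP => l.
  have [hk|hk] := boolP ((k \in monalg.msupp f) || (k \in monalg.msupp g)).
    have hstd : std k by case/orP: hk; apply: direct_sum_supp.
    by rewrite !mcoeff_direct_sum // e.
  by case/norP: hk => kf kg; rewrite !mcoeff_outdom.
(* The preimage of [p] places its residue parts at the corresponding standard exponents. *)
have [E [uniqE stdE mapE]] := standard_exp_enum.
pose f : monalg.malg 'X_{1..n} {poly K} :=
  \sum_(k <- E) mkmalgU k (residue_part (tail_weight a k) p).
have fE k : monalg.mcoeff k f =
    if k \in E then residue_part (tail_weight a k) p else 0.
  rewrite /f raddf_sum /= (eq_bigr (fun k' => if k' == k then
     residue_part (tail_weight a k') p else 0)); last first.
    by move=> k' _; rewrite mcoeffU mulrb.
  rewrite -big_mkcond /= -big_filter; case: ifPn => hk.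
    by rewrite filter_pred1_uniq // big_seq1.
  rewrite big_seq_cond big1 // => k' /andP[].
  by rewrite mem_filter => /andP[/eqP -> hk'] _; rewrite hk' in hk.
exists f.
  move=> k; rewrite fE; split=> [hk|hk].
    have -> : k \in E by apply/stdE.
    by apply: residue_part_rank_one => //; apply: apery_tail_weight.
  by case: ifP => // /stdE.
have sum_map0 : @sum_map K 'X_{1..n} 0 = 0.
  by rewrite /sum_map monalg.msupp0 big_seq_fset0.
rewrite /f (big_morph _ (@sum_mapD _) sum_map0).
rewrite (eq_bigr (fun k => residue_part (tail_weight a k) p)); last first.
  by move=> k _; apply: sum_mapU.
rewrite -(big_map (tail_weight a) predT (residue_part^~ p)) mapE.
exact: sum_residue_part.
Qed.

(** * Hilbert series *)

(** The boolean is coerced to the dimension 0 or 1; in the latter case ['X^l] is a basis. *)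
Lemma graded_piece_dim l : has_dim (graded_piece A l) (in_semigroup a l).
Proof.
have [hl|hl] := boolP (in_semigroup a l); last first.
  exists (fun=> 0); split=> [[]|c _ []|v [/semigroup_ringE hv [c e]]] //.
  exists (fun=> 0); rewrite big_ord0 e.
  have [->|c0] := eqVneq c 0; first exact: scale0r.
  case/negP: hl; apply/(in_semigroupP a_gt0)/hv.
  by rewrite e coefZ coefXn eqxx mulr1.
exists (fun=> 'X^l); split=> [i|c|v [_ [c ->]]].
- split; last by exists 1; rewrite scale1r.
  by apply: semigroup_ringXn; apply/(in_semigroupP a_gt0).
- rewrite big_ord1 => /eqP.
  rewrite scaler_eq0 -size_poly_eq0 size_polyXn orbF => /eqP c0 i.
  by rewrite (ord1 i).
by exists (fun=> c); rewrite big_ord1.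
Qed.

(** Multiplying the indicator series of [S] by 1 - t^a1 subtracts its shift by [a1]. As [S] is
    stable under adding [a1], the indicator of the Apery set remains. *)
Lemma hilbert_series_quotient E : map (tail_weight a) E = apery_seq ->
  is_series_quotient (fun l => (in_semigroup a l)%:R)
    (series_of_poly (\sum_(k <- E) 'X^(tail_weight a k)))
    (series_of_poly (1 - 'X^a1)).
Proof.
move=> mapE; split.
  by rewrite /series_of_poly coefB coef1 coefXn (ltn_eqF a1_gt0) subr0 unitr1.
move=> l; rewrite /series_mul /series_of_poly.
rewrite -(big_map (tail_weight a) predT (fun s => 'X^s)) mapE coef_sum.
transitivity ((apery l)%:R : int); last first.
  rewrite (eq_bigr (fun s => if s == l then 1 else 0)) => [|s _]; last first.
    by rewrite coefXn eq_sym; case: eqP.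
  rewrite -big_mkcond /= -big_filter; have [hl|hl] := boolP (apery l).
    by rewrite filter_pred1_uniq ?apery_seq_uniq ?mem_apery_seq // big_seq1.
  rewrite big_seq_cond big1 // => s /andP[]; rewrite mem_filter mem_apery_seq.
  by case/andP=> /eqP -> h; rewrite h in hl.
(* Only the indices [l] and, when [a1 <= l], [l - a1] contribute to the convolution. *)
have coefD (i : 'I_l.+1) : (1 - 'X^a1 : {poly int})`_(l - i) =
    (i == ord_max)%:R - ((a1 <= l)%N && (i == inord (l - a1)))%:R.
  rewrite coefB coef1 coefXn -!val_eqE /=; congr (_%:R - _%:R).
    by have := ltn_ord i; lia.
  case: leqP => h; last by have := ltn_ord i; lia.
  by rewrite inordK; have := ltn_ord i; lia.
under eq_bigr do rewrite coefD mulrBr.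
rewrite big_split /= sumrN (bigD1 ord_max) //= eqxx mulr1 big1 ?addr0; last first.
  by move=> i /negbTE ->; rewrite mulr0.
rewrite /apery; have [h|h] /= := leqP a1 l; last first.
  by rewrite big1 ?subr0 ?andbT // => i _; rewrite mulr0.
rewrite (bigD1 (inord (l - a1))) //= eqxx mulr1 big1 ?addr0; last first.
  by move=> i /negbTE ->; rewrite mulr0.
rewrite inordK; last by lia.
case hl : (in_semigroup a (l - a1)); last by rewrite subr0 andbT.
suff -> : in_semigroup a l by rewrite subrr.
apply/(in_semigroupP a_gt0); rewrite -(subnK h); apply: semigroup_genD.
  exact/(in_semigroupP a_gt0).
exact: semigroup_gen_gen.
Qed.

(** * Frobenius number *)

Lemma gcd_gens_gt0 : (0 < gcd_gens a)%N.
Proof. by rewrite /gcd_gens big_ord_recl gcdn_gt0 a_gt0. Qed.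

Lemma gcd_gens_dvd i : (gcd_gens a %| a i)%N.
Proof. by rewrite /gcd_gens (bigD1 i) //= dvdn_gcdl. Qed.

(* Up to a multiple of a1, Bezout coefficients can be taken nonnegative. *)
Lemma gcd_gens_eqmod c : exists2 s, S s & s = c * gcd_gens a %[mod a1].
Proof.
suff [s hs e] : exists2 s, S s & s = gcd_gens a %[mod a1].
  by exists (c * s)%N; [apply: semigroup_genM | rewrite -modnMmr e modnMmr].
rewrite /gcd_gens; elim/big_ind: _ => [|x y [s hs sx] [s' hs' sy]|i _].
- by exists 0%N => //; apply: semigroup_gen0.
- have [->|x_gt0] := posnP x; first by rewrite gcd0n; exists s'.
  have [u _ /dvdnP[q e]] := Bezoutl y x_gt0.
  (* Bezout reads [gcdn x y + u * y = q * x]; the coefficient -u is replaced by [a1.-1 * u],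
     congruent to it modulo [a1]. *)
  exists (q * s + (a1.-1 * u) * s')%N.
    by apply: semigroup_genD; apply: semigroup_genM.
  rewrite -modnDm -(modnMmr q) sx -(modnMmr (a1.-1 * u)) sy.
  rewrite modnMmr modnMmr modnDm -e.
  rewrite -addnA; have -> : (u * y + a1.-1 * u * y = u * y * a1)%N.
    by rewrite -mulnA -mulSn prednK // mulnC.
  by rewrite addnC modnMDl.
by exists (a i) => //; apply: semigroup_gen_gen.
Qed.

Lemma semigroup_gen_dvd s : S s -> (gcd_gens a %| s)%N.
Proof.
by case=> k ->; apply: dvdn_sum => i _; rewrite dvdn_mull ?gcd_gens_dvd.
Qed.

Lemma semigroup_gen_quotient s :
  semigroup_gen (fun i => (a i %/ gcd_gens a)%N) s <-> S (gcd_gens a * s)%N.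
Proof.
have e (k : 'I_n.+1 -> nat) :
   (gcd_gens a * \sum_(i < n.+1) k i * (a i %/ gcd_gens a) =
    \sum_(i < n.+1) k i * a i)%N.
  rewrite big_distrr /=; apply: eq_bigr => i _.
  by rewrite mulnCA [X in (_ * X)%N]mulnC divnK ?gcd_gens_dvd.
split=> [[k ->]|[k /eqP]]; first by exists k; rewrite e.
by rewrite -e eqn_pmul2l ?gcd_gens_gt0 // => /eqP ->; exists k.
Qed.

Lemma apery_class_exists c :
  exists2 w, apery w & w = c * gcd_gens a %[mod a1].
Proof.
have [s hs e] := gcd_gens_eqmod c; have [w [j [hw sw]]] := apery_decomp hs.
by exists w => //; rewrite -e sw addnC modnMDl.
Qed.

Lemma apery_max_exists : exists2 m, apery m & forall s, apery s -> (s <= m)%N.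
Proof.
have h0 : apery 0.
  rewrite /apery leqNgt a1_gt0 andbT; apply/(in_semigroupP a_gt0).
  exact: semigroup_gen0.
have hex : exists s, apery s by exists 0%N.
have [m hm mmax] := ex_maxnP hex apery_ub.
by exists m.
Qed.

(** With d the gcd, g d + a1 is the Apery element [m], so g d is not in [S]. For z > g, the Apery
    element w congruent to z d satisfies w <= m < z d + a1, so z d - w is a nonnegative multiple of
    [a1]. *)
Lemma frobenius_apery m (g : int) : apery m -> (forall s, apery s -> (s <= m)%N) ->
  g * (gcd_gens a)%:Z = m%:Z - a1%:Z ->
  is_frobenius_number (semigroup_gen (fun i => (a i %/ gcd_gens a)%N)) g.
Proof.
move=> hm mmax e; have d_gt0 := gcd_gens_gt0; split.
  case=> s gs /semigroup_gen_quotient hs; apply: (apery_not_sub hs).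
  suff -> : (gcd_gens a * s + a1 = m)%N by [].
  by move: e; rewrite gs; lia.
move=> z lt_gz.
set d := gcd_gens a in d_gt0 e *.
(* As [z] may be negative a priori, it is first shifted by a multiple of [a1] to a natural number in
   the same class. *)
pose N := `|z|%N; pose c := absz (z + (N * a1)%:Z).
have cE : c%:Z = z + (N * a1)%:Z by rewrite /c gez0_abs //; rewrite /N; nia.
have [w hw ew] := apery_class_exists c; rewrite -/d in ew.
have le_wm := mmax _ hw.
(* The integer quotient of z d - w by [a1], with the shift undone. *)
pose q := ((c * d) %/ a1)%:Z - (w %/ a1)%:Z - (N * d)%:Z.
have zE : z * d%:Z = w%:Z + q * a1%:Z.
  have h1 := divn_eq (c * d) a1; have h2 := divn_eq w a1.
  have h3 : (c * d)%:Z = z * d%:Z + (N * a1 * d)%:Z by rewrite PoszM cE; lia.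
  rewrite /q; move: h1 h2 h3; rewrite ew; lia.
have q_ge0 : 0 <= q by nia.
have z_ge0 : 0 <= z by nia.
exists `|z|%N; first by rewrite gez0_abs.
apply/semigroup_gen_quotient.
have -> : (gcd_gens a * `|z| = w + `|q| * a1)%N by rewrite -/d; nia.
exact/semigroup_addM/apery_in_semigroup.
Qed.
End Apery.

Theorem theorem3p1 (K : fieldType) (n : nat) (a : 'I_n.+1 -> nat)
    (a_gt0 : forall i, (0 < a i)%N) :
  let lambda := gcd_gens a in
  let S' := semigroup_gen (fun i => (a i %/ lambda)%N) in
  let A := semigroup_ring (K := K) a in
  let x1 := fun _ : 'I_1 => 'X^(a ord0) : {poly K} in
  let B := subalg_gen x1 in
  let std := standard_exp K a in
  (noether_normalization x1 A /\
   module_iso (V := {poly K}^o) B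
     (direct_sum std (fun k => rank_one_module B (tail_weight a k)))
     A (@sum_map K 'X_{1..n})) /\
  (exists (P : nat -> int) (E : seq 'X_{1..n}),
     [/\ is_hilbert_series A P,
         uniq E,
         (forall k, k \in E <-> std k)
       & is_series_quotient P
           (series_of_poly (\sum_(k <- E) 'X^(tail_weight a k)))
           (series_of_poly (1 - 'X^(a ord0)))]) /\
  (exists (g : int) (M : nat),
     [/\ is_frobenius_number S' g,
         is_maximum (fun s => exists2 k, std k & s = tail_weight a k) M
       & g%:~R = (M%:R - (a ord0)%:R) / lambda%:R :> rat]).
Proof.
move=> lambda S' A x1 B std.
have [E [uniqE stdE mapE]] := standard_exp_enum K a_gt0.
have [m hm mmax] := apery_max_exists a_gt0.
split; first by split; [exact: noether_normalization_x1|exact: direct_sum_iso].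
split.
  exists (fun l => (in_semigroup a l)%:R), E; split=> //; last first.
    exact: hilbert_series_quotient.
  by move=> l; exists (in_semigroup a l); [exact: graded_piece_dim|rewrite natz].
(* Both divisions are exact, since [lambda] divides every element of the semigroup. *)
pose g : int := (m %/ lambda)%:Z - (a ord0 %/ lambda)%:Z.
have e : g * lambda%:Z = m%:Z - (a ord0)%:Z.
  rewrite mulrBl -!PoszM !divnK ?gcd_gens_dvd //.
  exact/semigroup_gen_dvd/apery_in_semigroup.
exists g, m; split; first exact: (frobenius_apery a_gt0 hm mmax e).
  split; first by have [k hk <-] := apery_standard_exp K a_gt0 hm; exists k.
  by move=> s [k hk ->]; apply: mmax; apply: apery_tail_weight hk.
have lambda_neq0 : lambda%:R != 0 :> rat by rewrite pnatr_eq0 -lt0n gcd_gens_gt0.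
apply: (canRL (mulfK lambda_neq0)).
by have := congr1 (fun z : int => z%:~R : rat) e; rewrite /= intrM intrB.
Qed.
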